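(* An abelian torsion group of infinite exponent cannot have a faithful representation as a self-similar group; that is, if $A$ is an abelian torsion group of infinite exponent, then for no $m\ge 2$ is $A$ isomorphic to a self-similar subgroup of $\mathcal{A}_m$.
   Context: $Y=\{1,\dots,m\}$ with $m\ge2$; $\mathcal{T}_m$ is the rooted $m$-ary tree whose vertices are the finite words over $Y$ (root the empty word, edges $(u,uy)$ with $y\in Y$), and $\mathcal{A}_m$ is its automorphism group, acting on the right. Each $\alpha\in\mathcal{A}_m$ is written $\alpha=(\alpha_1,\dots,\alpha_m)\sigma(\alpha)$, where $\sigma(\alpha)\in Sym(Y)$ is the permutation induced on the first level, $\alpha_y\in\mathcal{A}_m$, and $(y_1y_2\cdots y_n)^{\alpha}=(y_1)^{\sigma(\alpha)}(y_2\cdots y_n)^{\alpha_{y_1}}$. The set of states of $\alpha$ is defined recursively by $Q(\alpha)=\{\alpha\}\cup\bigcup_{i=1}^m Q(\alpha_i)$. A subgroup $G\leqslant\mathcal{A}_m$ is self-similar if $Q(\alpha)\subseteq G$ for all $\alpha\in G$. No transitivity on the first level is assumed. A torsion group has infinite exponent if the orders of its elements are unbounded. *)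

(* Defs.v *)
From HB Require Import structures.
From mathcomp Require Import all_boot all_fingroup.
From mathcomp Require Import boolp classical_sets.

Set Implicit Arguments.
Unset Strict Implicit.
Unset Printing Implicit Defensive.

Local Open Scope classical_set_scope.
Local Open Scope group_scope.

(** * The rooted m-ary tree *)

(* Words over Y = 'I_m; the root is [::]. *)
Definition word (m : nat) := seq 'I_m.

Definition tree_edge (m : nat) (u v : word m) : Prop :=
  exists y : 'I_m, v = rcons u y.

Definition is_tree_aut (m : nat) (f : word m -> word m) : Prop :=
  [/\ bijective f, f [::] = [::] &
      forall u v, tree_edge (f u) (f v) <-> tree_edge u v].

Record tree_aut (m : nat) := TreeAut {
  tree_aut_fun :> word m -> word m;
  tree_autP : is_tree_aut tree_aut_fun }.

Lemma tree_aut_ext m (a b : tree_aut m) : a =1 b -> a = b.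
Proof.
case: a b => [f fP] [g gP] /= /funext fg; subst g.
by congr TreeAut; exact: Prop_irrelevance.
Qed.

(** * The group of automorphisms of the tree *)

Section Group.
Variable m : nat.
Implicit Types a b c : tree_aut m.

Lemma is_tree_aut_id : is_tree_aut (@id (word m)).
Proof. by split=> //; exists id. Qed.

Lemma is_tree_aut_comp a b : is_tree_aut (b \o a).
Proof.
case: (tree_autP a) (tree_autP b) => [bija a0 ae] [bijb b0 be].
split; first exact: bij_comp.
  by rewrite /= a0.
by move=> u v /=; split=> [/be/ae //|/ae/be].
Qed.

Lemma tree_aut_has_inv a : {g : word m -> word m | cancel a g /\ cancel g a}.
Proof. by apply: cid; case: (tree_autP a) => -[g ag ga] _ _; exists g. Qed.

Lemma is_tree_aut_inv a : is_tree_aut (sval (tree_aut_has_inv a)).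
Proof.
case: tree_aut_has_inv => g /= [ag ga]; case: (tree_autP a) => [_ a0 ae].
split; first by exists a.
  by rewrite -[in LHS]a0 ag.
by move=> u v; rewrite -ae !ga.
Qed.

Definition tree_aut_one := TreeAut is_tree_aut_id.

(* Automorphisms act on the right: u^(a * b) = (u^a)^b. *)
Definition tree_aut_mul a b := TreeAut (is_tree_aut_comp a b).

Definition tree_aut_inv a := TreeAut (is_tree_aut_inv a).

HB.instance Definition _ := gen_eqMixin (tree_aut m).
HB.instance Definition _ := gen_choiceMixin (tree_aut m).

Fact tree_aut_mulA : associative tree_aut_mul.
Proof. by move=> a b c; apply: tree_aut_ext. Qed.

Fact tree_aut_mul1 : left_id tree_aut_one tree_aut_mul.
Proof. by move=> a; apply: tree_aut_ext. Qed.

Fact tree_aut_mulr1 : right_id tree_aut_one tree_aut_mul.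
Proof. by move=> a; apply: tree_aut_ext. Qed.

Fact tree_aut_mulV : left_inverse tree_aut_one tree_aut_inv tree_aut_mul.
Proof.
move=> a; apply: tree_aut_ext => u /=.
by case: tree_aut_has_inv => g /= [_ ga]; rewrite ga.
Qed.

Fact tree_aut_mulrV : right_inverse tree_aut_one tree_aut_inv tree_aut_mul.
Proof.
move=> a; apply: tree_aut_ext => u /=.
by case: tree_aut_has_inv => g /= [ag _]; rewrite ag.
Qed.

HB.instance Definition _ := isGroup.Build (tree_aut m)
  tree_aut_mulA tree_aut_mul1 tree_aut_mulr1 tree_aut_mulV tree_aut_mulrV.

End Group.

Lemma tree_aut1E m (u : word m) : (1 : tree_aut m) u = u.
Proof. by []. Qed.

Lemma tree_autME m (a b : tree_aut m) u : (a * b) u = b (a u).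
Proof. by []. Qed.

(** * The decomposition a = (a_1, ..., a_m) sigma(a) *)

Section Decomposition.
Variable m : nat.
Implicit Types (a : tree_aut m) (y : 'I_m) (w : word m).

Lemma tree_aut_inj a : injective a.
Proof. by case: (tree_autP a) => /bij_inj. Qed.

Lemma tree_aut_nil a : a [::] = [::].
Proof. by case: (tree_autP a). Qed.

Lemma tree_aut_rcons a w y : exists z, a (rcons w y) = rcons (a w) z.
Proof. by case: (tree_autP a) => _ _ ae; apply/ae; exists y. Qed.

Definition level1 a y : 'I_m := head y (a [:: y]).

(* The section a_y is computed by deleting the first letter of (y w)^a. *)
Definition section_fun a y w : word m := behead (a (y :: w)).

Lemma tree_aut_cons a y w : a (y :: w) = level1 a y :: section_fun a y w.
Proof.
rewrite /section_fun; elim/last_ind: w => [|w x IHw].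
  have [z] := tree_aut_rcons a [::] y.
  by rewrite /level1 tree_aut_nil /= => ->.
by rewrite -rcons_cons; have [z ->] := tree_aut_rcons a (y :: w) x; rewrite IHw.
Qed.

Lemma section_fun_nil a y : section_fun a y [::] = [::].
Proof.
have [z] := tree_aut_rcons a [::] y.
by rewrite /section_fun tree_aut_nil /= => ->.
Qed.

Lemma level1_inj a : injective (level1 a).
Proof.
move=> y z yz; have: [:: y] = [:: z] by
  apply: (@tree_aut_inj a); rewrite !tree_aut_cons !section_fun_nil yz.
by case.
Qed.

Definition sigma a : 'S_m := perm (@level1_inj a).

Lemma level1V a y : level1 a^-1 (level1 a y) = y.
Proof.
have := tree_autME a a^-1 [:: y].
by rewrite mulgV tree_aut1E !tree_aut_cons => -[].
Qed.

Lemma is_tree_aut_section a y : is_tree_aut (section_fun a y).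
Proof.
have tl (b : tree_aut m) x w :
    section_fun b^-1 (level1 b x) (section_fun b x w) = w.
  have := tree_autME b b^-1 (x :: w).
  by rewrite mulgV tree_aut1E !tree_aut_cons => -[].
split; last 1 first.
- case: (tree_autP a) => _ _ ae u v.
  have edge_cons (x : 'I_m) (s t : word m) :
      tree_edge (x :: s) (x :: t) <-> tree_edge s t.
    by split=> -[z]; [case=> ->; exists z | move->; exists z].
  by rewrite -(edge_cons (level1 a y)) -!tree_aut_cons ae edge_cons.
- exists (section_fun a^-1 (level1 a y)) => w; first exact: tl.
  by have := tl a^-1 (level1 a y) w; rewrite invgK level1V.
- exact: section_fun_nil.
Qed.

Definition section a y : tree_aut m := TreeAut (is_tree_aut_section a y).

Lemma tree_aut_decomposition a y w :
  a (y :: w) = sigma a y :: section a y w.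
Proof. by rewrite permE tree_aut_cons. Qed.

End Decomposition.

(** * Self-similar subgroups *)

(* [states a b] means b \in Q(a). *)
Inductive states (m : nat) (a : tree_aut m) : tree_aut m -> Prop :=
| states_self : states a a
| states_section (y : 'I_m) (b : tree_aut m) :
    states (section a y) b -> states a b.

Definition self_similar_subgroup (m : nat) (G : set (tree_aut m)) : Prop :=
  group_closed (mem G) /\ forall a, G a -> [set b | states a b] `<=` G.

Definition isomorphic_to_subgroup (A H : groupType) (G : set H) : Prop :=
  exists phi : {multiplicative A -> H}, injective phi /\ range phi = G.

(** * Abelian torsion groups of infinite exponent *)

Definition abelian_group (A : groupType) : Prop := forall x y : A, commute x y.

Definition torsion_group (A : groupType) : Prop :=
  forall x : A, exists2 n : nat, 0 < n & x ^+ n = 1.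

Definition has_order (A : groupType) (x : A) (n : nat) : Prop :=
  [/\ 0 < n, x ^+ n = 1 & forall k : nat, 0 < k -> x ^+ k = 1 -> n <= k].

Definition infinite_exponent (A : groupType) : Prop :=
  forall N : nat, exists (x : A) (n : nat), has_order x n /\ N < n.

(* Main.v *)
(** Let [G] be an abelian self-similar torsion group. As [G] induces finitely
    many permutations on the first level, some [N > 0] kills a transversal in
    [G] of the first-level stabilizer [H], so that the [N]-th powers of
    elements of [G] are already [N]-th powers of elements of [H]. Powers in [H]
    are computed section by section and the sections lie in [G], so [N]-th
    powers of elements of [G] fix every vertex, by induction on its level. *)

Require Import Defs.
From mathcomp Require Import all_boot all_fingroup.
From mathcomp Require Import boolp classical_sets.

Set Implicit Arguments.
Unset Strict Implicit.
Unset Printing Implicit Defensive.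

Local Open Scope group_scope.

(* [gmulfXn] asks for a [UMagmaMorphism]; between groups, preservation of [1]
   is automatic. *)
Lemma multiplicative1 (A H : groupType) (f : {multiplicative A -> H}) : f 1 = 1.
Proof. by apply: (mulgI (f 1)); rewrite -gmulfM !mulg1. Qed.

Lemma multiplicativeX (A H : groupType) (f : {multiplicative A -> H}) n :
  {morph f : x / x ^+ n}.
Proof.
move=> x; elim: n => [|n IHn]; first by rewrite !expg0 multiplicative1.
by rewrite !expgS gmulfM IHn.
Qed.

Lemma level1M m (a b : tree_aut m) y :
  level1 (a * b) y = level1 b (level1 a y).
Proof.
by have := tree_autME a b [:: y]; rewrite !tree_aut_cons => -[].
Qed.

(** As [h] fixes [y], every factor of the power acts below [y] through the same section. *)
Lemma level1_stabilizer_expg m (h : tree_aut m) n y (w : word m) :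
  level1 h =1 id -> (h ^+ n) (y :: w) = y :: (section h y ^+ n) w.
Proof.
move=> h1; elim: n => [|n IHn]; first by rewrite !expg0.
by rewrite !expgSr !tree_autME IHn tree_aut_cons h1.
Qed.

Section AbelianTorsion.

Variables (m : nat) (G : set (tree_aut m)).
Hypothesis ssG : self_similar_subgroup G.
Hypothesis abelG : forall g h, G g -> G h -> commute g h.
Hypothesis torsG : forall g, G g -> exists2 n : nat, 0 < n & g ^+ n = 1.

Lemma self_similar1 : G 1.
Proof. by case: ssG => -[/set_mem]. Qed.

Lemma self_similarMV g h : G g -> G h -> G (g * h^-1).
Proof.
case: ssG => -[_ +] _; move=> clG Gg Gh.
by apply/set_mem/clG; exact/mem_set.
Qed.

Lemma self_similar_section g y : G g -> G (section g y).
Proof.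
case: ssG => _ stG Gg; apply: (stG _ Gg) => /=.
exact/states_section/states_self.
Qed.

Lemma expg_level1_stabilizer :
  exists2 N : nat, 0 < N & forall g, G g ->
    exists h, [/\ G h, level1 h =1 id & g ^+ N = h ^+ N].
Proof.
have rep (s : 'S_m) : exists p : tree_aut m * nat,
    [/\ G p.1, 0 < p.2, p.1 ^+ p.2 = 1
      & forall g, G g -> sigma g = s -> sigma p.1 = s].
  have [[g [Gg gs]]|nog] := pselect (exists g, G g /\ sigma g = s).
    by have [n n_gt0 gn1] := torsG Gg; exists (g, n).
  (* No element of [G] induces [s]: this default contributes a factor 1 to the product defining the
     exponent. *)
  exists (1, 1%N); split=> //=; first exact: self_similar1.
  by move=> g Gg gs; case: nog; exists g.
have [t tP] := choice rep.
exists (\prod_s (t s).2)%N.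
  by apply: prodn_gt0 => s; have [] := tP s.
move=> g Gg; have [Gt _ tn1 /(_ g Gg erefl) sgt] := tP (sigma g).
set k := (t (sigma g)).1 in Gt tn1 sgt *.
(* [k] induces the same permutation as [g], and its killing exponent is one factor of the product,
   so [k] disappears from the power. *)
exists (g * k^-1); split; first exact: self_similarMV.
  move=> y; rewrite level1M.
  have -> : level1 g y = level1 k y by have /permP/(_ y) := sgt; rewrite !permE.
  exact: level1V.
have cgk : commute g k^-1 by apply/commuteV/abelG.
rewrite expgMn // expVgn (bigD1 (sigma g)) //= -/k.
by rewrite [k ^+ _]expgM tn1 expg1n invg1 mulg1.
Qed.

Lemma self_similar_abelian_torsion_exponent :
  exists2 N : nat, 0 < N & forall g, G g -> g ^+ N = 1.
Proof.
have [N N_gt0 NP] := expg_level1_stabilizer; exists N => // g Gg.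
apply: tree_aut_ext => w; rewrite tree_aut1E.
(* [g] must vary: the induction hypothesis is applied to [section h y]. *)
elim: w g Gg => [|y w IHw] g Gg; first exact: tree_aut_nil.
have [h [Gh h1 ->]] := NP g Gg.
by rewrite level1_stabilizer_expg // IHw //; exact: self_similar_section.
Qed.

End AbelianTorsion.

Theorem corollary1p1 (A : groupType) (abelA : abelian_group A)
    (torsA : torsion_group A) (infA : infinite_exponent A)
    (m : nat) (m_ge2 : 2 <= m) :
  ~ exists G : set (tree_aut m),
      self_similar_subgroup G /\ isomorphic_to_subgroup A G.
Proof.
case=> G [ssG [phi [phi_inj phiG]]].
have imG x : G (phi x) by rewrite -phiG; exists x.
have [||N N_gt0 GN1] := self_similar_abelian_torsion_exponent ssG.
- rewrite -phiG => _ _ [x _ <-] [y _ <-].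
  by rewrite /commute -!gmulfM abelA.
- rewrite -phiG => _ [x _ <-]; have [n n_gt0 xn1] := torsA x.
  by exists n; rewrite // -multiplicativeX xn1 multiplicative1.
have [x [n [[_ _ min_n]]]] := infA N.
rewrite ltnNge min_n //; apply: phi_inj.
by rewrite multiplicativeX multiplicative1 GN1.
Qed.
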